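(* For every $n\ge1$ and $k\ge1$, $$h_n\!\left[\frac{1}{(1-q_1)\cdots(1-q_k)}\right]=\frac{\sum_{\sigma^1\cdots\sigma^k=\epsilon}q_1^{\mathrm{comaj}(\sigma^1)}\cdots q_k^{\mathrm{comaj}(\sigma^k)}}{(q_1;q_1)_n\cdots(q_k;q_k)_n},$$ the sum running over all $k$-tuples $(\sigma^1,\dots,\sigma^k)\in S_n^{\times k}$ whose product $\sigma^1\cdots\sigma^k$ is the identity $\epsilon$.
   Context: $h_n$ is the complete homogeneous symmetric function, evaluated at all monomials $q_1^{a_1}\cdots q_k^{a_k}$, $a\in\mathbb{N}^k$. $(q;t)_r=(1-q)(1-qt)\cdots(1-qt^{r-1})$. For $\sigma\in S_n$, $\mathrm{comaj}(\sigma)=\sum_{i:\sigma_i>\sigma_{i+1}}(n-i)$. *)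

(* Defs.v *)
From mathcomp Require Import all_boot all_order all_algebra all_fingroup.
From mathcomp Require Import mpoly.
Set Implicit Arguments. Unset Strict Implicit. Unset Printing Implicit Defensive.
Import GRing.Theory.

(* comaj of a permutation s of {1..n}, written in one-line notation s_1 ... s_n.
   0-indexed: a descent at 1-indexed position p (s_p > s_(p+1)) contributes n - p.
   Here i, j : 'I_n are 0-indexed positions with j = i+1, so p = j. *)
Definition comaj (n : nat) (s : 'S_n) : nat :=
  \sum_(i : 'I_n) \sum_(j : 'I_n | (val j == i.+1) && (s j < s i)) (n - j).

(* Coefficient of q^b (b : exponent vector) in the formal power series
   h_n[ sum_{a in N^k} q^a ] = h_n evaluated at the (infinite) alphabet of all
   monomials q_1^{a_1}...q_k^{a_k}: it is the number of multisets of size n of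
   exponent vectors a in N^k whose sum is b.  A multiset is encoded by its
   multiplicity function c; only vectors a with entries <= max_i b_i can occur,
   so a ranges over the finite type {ffun 'I_k -> 'I_(B.+1)}, B = max_i b_i,
   and multiplicities are <= n. *)
Definition hcoef (k n : nat) (b : 'X_{1..k}) : nat :=
  let B := \max_(i < k) b i in
  #|[set c : {ffun {ffun 'I_k -> 'I_B.+1} -> 'I_n.+1} |
      (\sum_(a : {ffun 'I_k -> 'I_B.+1}) (c a : nat) == n) &&
      [forall i : 'I_k, \sum_(a : {ffun 'I_k -> 'I_B.+1}) (c a : nat) * a i == b i]]|.

Definition mul_hcoef (k n : nat) (D : {mpoly int[k]}) (b : 'X_{1..k}) : int :=
  (\sum_(m <- msupp D | lem m b) D@_m * (hcoef n (mnm_sub b m))%:Z)%R.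

Definition qpoch (k : nat) (q t : {mpoly int[k]}) (r : nat) : {mpoly int[k]} :=
  (\prod_(j < r) (1 - q * t ^+ j))%R.

Definition denom (k n : nat) : {mpoly int[k]} :=
  (\prod_(i < k) qpoch 'X_i 'X_i n)%R.

Definition numer (k n : nat) : {mpoly int[k]} :=
  (\sum_(s : {ffun 'I_k -> 'S_n} | (\prod_(i < k) s i)%g == 1%g)
     'X_[ [multinom comaj (s i) | i < k] ])%R.

(* Main.v *)
Require Import Defs.
From mathcomp Require Import all_boot all_order all_algebra all_fingroup.
From mathcomp Require Import mpoly zify ring.
Set Implicit Arguments. Unset Strict Implicit. Unset Printing Implicit Defensive.
Import GRing.Theory.

(* A multiset of n vectors of N^k is a k x n matrix with lexicographically
   sorted columns.  Radix-sort an arbitrary matrix: starting from the identity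
   ordering of the columns, sort stably by the last row, then by the one before,
   and so on up to the first row.  If t_i is the ordering obtained after
   processing rows i, ..., k-1, then s_i = t_i t_(i+1)^-1 records the effect of
   the i-th sort, and row i read in the ordering t_i is a weakly increasing
   sequence which is strictly increasing at the descents of s_i; such pairs
   determine the matrix.  The product of the s_i is t_0, which is the identity
   exactly when the columns were sorted to begin with.  Finally, weakly
   increasing sequences of length n which are strict at the descents of s have
   generating function q^(comaj s) / (q; q)_n, as the gaps beyond the forced
   increments are arbitrary. *)

(** * Bijections of finite sets, and splitting off the first entry of a finite function *)

Lemma card_bij_in (S T : finType) (A : {pred S}) (C : {pred T})
    (f : S -> T) (g : T -> S) :
    {in A, forall x, f x \in C} -> {in C, forall y, g y \in A} ->
    {in A, cancel f g} -> {in C, cancel g f} ->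
  #|A| = #|C|.
Proof.
move=> fA gC fK gK; apply/eqP; rewrite eqn_leq; apply/andP; split.
  rewrite -(card_in_image (can_in_inj fK)).
  by apply/subset_leq_card/subsetP => _ /imageP[x Ax ->]; exact: fA.
rewrite -(card_in_image (can_in_inj gK)).
by apply/subset_leq_card/subsetP => _ /imageP[x Ax ->]; exact: gC.
Qed.

Definition fcons (S : finType) k (x : S) (g : {ffun 'I_k -> S}) :
    {ffun 'I_k.+1 -> S} :=
  [ffun i => if unlift ord0 i is Some j then g j else x].

Definition ftail (S : finType) k (f : {ffun 'I_k.+1 -> S}) : {ffun 'I_k -> S} :=
  [ffun i => f (lift ord0 i)].

Lemma fcons0 (S : finType) k (x : S) (g : {ffun 'I_k -> S}) :
  fcons x g ord0 = x.
Proof. by rewrite ffunE unlift_none. Qed.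

Lemma fconsS (S : finType) k (x : S) (g : {ffun 'I_k -> S}) i :
  fcons x g (lift ord0 i) = g i.
Proof. by rewrite ffunE liftK. Qed.

Lemma ftail_cons (S : finType) k (x : S) (g : {ffun 'I_k -> S}) :
  ftail (fcons x g) = g.
Proof. by apply/ffunP => i; rewrite ffunE fconsS. Qed.

Lemma fcons_tail (S : finType) k (f : {ffun 'I_k.+1 -> S}) :
  fcons (f ord0) (ftail f) = f.
Proof. by apply/ffunP => i; rewrite ffunE; case: unliftP => [j|] ->; rewrite ?ffunE. Qed.

Lemma sum_fcons (S : finType) k (F : {ffun 'I_k.+1 -> S} -> nat) :
  \sum_f F f = \sum_(g : {ffun 'I_k -> S}) \sum_(x : S) F (fcons x g).
Proof.
rewrite pair_bigA /= (reindex (fun p : {ffun 'I_k -> S} * S => fcons p.2 p.1)) //=.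
exists (fun f => (ftail f, f ord0)) => [[g x] _|f _] /=.
  by rewrite ftail_cons fcons0.
exact: fcons_tail.
Qed.

Lemma big_ffun0 (S : finType) (F : {ffun 'I_0 -> S} -> nat) (f0 : {ffun 'I_0 -> S}) :
  \sum_f F f = F f0.
Proof.
by rewrite (big_pred1 f0) // => f; symmetry; apply/eqP/ffunP => -[].
Qed.

(** * Stable sorting, seen through permutations *)

(* Since s is injective, this says that l is weakly increasing, and strictly so
   at the descents of s (see compat_desc). *)
Definition compat n B (s : 'S_n) (l : {ffun 'I_n -> 'I_B.+1}) :=
  [forall p : 'I_n, forall q : 'I_n, (p < q) ==> (l p < l q) || (l p == l q) && (s p < s q)].

Lemma compatP n B (s : 'S_n) (l : {ffun 'I_n -> 'I_B.+1}) :
  reflect (forall p q : 'I_n, p < q -> (l p < l q) || (l p == l q) && (s p < s q))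
          (compat s l).
Proof.
by apply: (iffP 'forall_'forall_implyP) => H p q; apply: H.
Qed.

Definition fperm n B (f : {ffun 'I_n -> 'I_B.+1}) (t : 'S_n) : {ffun 'I_n -> 'I_B.+1} :=
  [ffun p => f (t p)].

(* The permutation r lists columns in their current order, r^-1 gives ranks. *)
Definition stable n B (f : {ffun 'I_n -> 'I_B.+1}) (r : 'S_n) : rel 'I_n :=
  fun x y => (f x < f y) || (f x == f y) && ((r^-1)%g x < (r^-1)%g y).

Lemma stable_trans n B (f : {ffun 'I_n -> 'I_B.+1}) r : transitive (stable f r).
Proof. by move=> y x z; rewrite /stable -!val_eqE /=; lia. Qed.

Lemma stable_irr n B (f : {ffun 'I_n -> 'I_B.+1}) r : irreflexive (stable f r).
Proof. by move=> x; rewrite /stable !ltnn andbF. Qed.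

Lemma stable_total n B (f : {ffun 'I_n -> 'I_B.+1}) r x y :
  x != y -> stable f r x y || stable f r y x.
Proof.
rewrite -(inj_eq (@perm_inj _ r^-1%g)) /stable -!val_eqE /=; lia.
Qed.

Lemma nth_codom_ord T n (f : 'I_n -> T) x (i : 'I_n) : nth x (codom f) i = f i.
Proof.
by rewrite /codom /image_mem (nth_map i) ?size_enum_ord // nth_ord_enum.
Qed.

(** The values of [s] and [enum 'I_n] are two strictly increasing lists with the same elements,
    hence the same list. *)
Lemma perm_mono1 n (s : 'S_n) : (forall p q : 'I_n, p < q -> s p < s q) -> s = 1%g.
Proof.
move=> H; have h1 : sorted ltn (map val (codom s)).
  rewrite sorted_map /codom /image_mem sorted_map.
  have := iota_ltn_sorted 0 n; rewrite -val_enum_ord sorted_map.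
  by apply: sub_sorted => p q; exact: H.
have h2 : map val (codom s) = map val (enum 'I_n).
  apply: (irr_sorted_eq ltn_trans ltnn h1).
    by rewrite val_enum_ord iota_ltn_sorted.
  move=> x; apply/mapP/mapP => -[i _ ->]; exists i => //; first by rewrite mem_enum.
  by apply/codomP; exists ((s^-1)%g i); rewrite permKV.
have {}h2 := inj_map val_inj h2.
apply/permP => p; rewrite perm1.
have := congr1 (fun u => nth p u p) h2.
by rewrite nth_codom_ord nth_ord_enum.
Qed.

Lemma sort_perm_exists n (r : rel 'I_n) :
    transitive r -> irreflexive r -> (forall x y, x != y -> r x y || r y x) ->
  exists t : 'S_n, forall p q : 'I_n, p < q -> r (t p) (t q).
Proof.
move=> rT rI rt.
(* The reflexive closure of [r] is a total relation, as sorting requires; since [s] has no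
   repetition, the equality case is excluded at distinct positions. *)
pose s := sort (fun x y => (x == y) || r x y) (enum 'I_n).
have ss : size s = n by rewrite size_sort size_enum_ord.
have us : uniq s by rewrite sort_uniq enum_uniq.
have st : sorted (fun x y => (x == y) || r x y) s.
  by apply: sort_sorted => x y; case: eqVneq => [->|/rt] //=.
have st' : pairwise (fun x y => (x == y) || r x y) s.
  rewrite -sorted_pairwise // => y x z /predU1P[->|h1] // /predU1P[<-|h2].
    by rewrite h1 orbT.
  by rewrite (rT _ _ _ h1 h2) orbT.
have fi : injective (fun p : 'I_n => nth p s p).
  move=> p q; rewrite (set_nth_default p) ?ss // => /eqP.
  by rewrite nth_uniq ?ss // => /eqP/val_inj.
exists (perm fi) => p q pq; rewrite !permE (set_nth_default p q) ?ss //.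
have := (pairwiseP p st') p q; rewrite !inE ss => /(_ (ltn_ord _) (ltn_ord _) pq).
by rewrite nth_uniq ?ss // ltn_eqF.
Qed.

(* The ordering obtained from r by stable sorting on f; the default value of
   odflt is never used (see sortpE). *)
Definition sortp n B (f : {ffun 'I_n -> 'I_B.+1}) (r : 'S_n) : 'S_n :=
  odflt 1%g [pick t : 'S_n | compat (t * r^-1)%g (fperm f t)].

(** The permutation [u * t^-1] sends [p] to the place of [u p] in the listing [t]. It preserves the
    order, so [perm_mono1] applies. *)
Lemma sort_perm_uniq n (r : rel 'I_n) (t u : 'S_n) :
    transitive r -> irreflexive r ->
    (forall p q : 'I_n, p < q -> r (t p) (t q)) ->
    (forall p q : 'I_n, p < q -> r (u p) (u q)) -> t = u.
Proof.
move=> rT rI rt ru; suff h : (u * t^-1)%g = 1%g.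
  by apply/esym; rewrite -(mul1g t) -h mulgKV.
apply: perm_mono1 => p q pq; rewrite !permM.
case: (ltngtP (t^-1 (u p))%g (t^-1 (u q))%g) => //.
  move=> /rt; rewrite !permKV => h; have := rT _ _ _ h (ru _ _ pq).
  by rewrite rI.
by move=> /val_inj /perm_inj /perm_inj pq'; rewrite pq' ltnn in pq.
Qed.

(** Unfolded, the right-hand side says that [t] lists the columns increasingly for [stable f r], and
    a strict total order has exactly one such listing. *)
Lemma sortpE n B (f : {ffun 'I_n -> 'I_B.+1}) (r t : 'S_n) :
  (sortp f r == t) = compat (t * r^-1)%g (fperm f t).
Proof.
have comE u : compat (u * r^-1)%g (fperm f u) <->
    forall p q : 'I_n, p < q -> stable f r (u p) (u q).
  by split=> [/compatP H p q /H|H]; [|apply/compatP => p q /H]; rewrite !ffunE !permM.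
have [t0 st0] := sort_perm_exists (@stable_trans _ _ f r) (@stable_irr _ _ f r)
  (@stable_total _ _ f r).
rewrite /sortp; case: pickP => [u cu|/(_ t0)]; last first.
  by move/negP => /(_ ((comE t0).2 st0)).
apply/eqP/idP => /= [<- //|ct].
exact: sort_perm_uniq (@stable_trans _ _ f r) (@stable_irr _ _ f r)
  ((comE u).1 cu) ((comE t).1 ct).
Qed.

(** This is the form in which sorts compose, because [stable] looks at the previous ordering only
    through its ranks. *)
Lemma sortp_lt n B (f : {ffun 'I_n -> 'I_B.+1}) (r : 'S_n) (x y : 'I_n) :
  (((sortp f r)^-1)%g x < ((sortp f r)^-1)%g y) = stable f r x y.
Proof.
have /compatP H : compat (sortp f r * r^-1)%g (fperm f (sortp f r)) by rewrite -sortpE.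
have {}H (p q : 'I_n) : ((sortp f r)^-1%g p < (sortp f r)^-1%g q) -> stable f r p q.
  by move=> /H; rewrite !ffunE !permM !permKV.
apply/idP/idP => [/H //|xy]; case: ltngtP => //.
  by move=> /H /(stable_trans xy); rewrite stable_irr.
by move=> /val_inj /perm_inj exy; rewrite exy stable_irr in xy.
Qed.

(** * Radix sort and the lexicographic order on columns *)

Fixpoint chain n B k : {ffun 'I_k -> {ffun 'I_n -> 'I_B.+1}} -> 'S_n :=
  match k with
  | 0 => fun _ => 1%g
  | k'.+1 => fun f => sortp (f ord0) (chain (ftail f))
  end.

Fixpoint lex B k : {ffun 'I_k -> 'I_B.+1} -> {ffun 'I_k -> 'I_B.+1} -> bool :=
  match k with
  | 0 => fun _ _ => true
  | k'.+1 => fun a c =>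
     (a ord0 < c ord0) || (a ord0 == c ord0) && lex (ftail a) (ftail c)
  end.

Lemma lex_total B k : total (@lex B k).
Proof.
elim: k => //= k IH a c; have := IH (ftail a) (ftail c).
by rewrite -!val_eqE /=; lia.
Qed.

Lemma lex_anti B k : antisymmetric (@lex B k).
Proof.
elim: k => [a c _|k IH a c /=]; first by apply/ffunP => -[].
rewrite -!val_eqE /= => h.
have e : a ord0 = c ord0 by apply: val_inj => /=; lia.
have et : ftail a = ftail c by apply: IH; move: h; rewrite e; lia.
by rewrite -(fcons_tail a) -(fcons_tail c) e et.
Qed.

Lemma lex_trans B k : transitive (@lex B k).
Proof.
elim: k => //= k IH c a d; have := IH (ftail c) (ftail a) (ftail d).
by rewrite -!val_eqE /=; lia.
Qed.

Definition column n B k (M : {ffun 'I_k -> {ffun 'I_n -> 'I_B.+1}}) (x : 'I_n) :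
  {ffun 'I_k -> 'I_B.+1} := [ffun i => M i x].

(** The last sort compares entries of row 0 and breaks ties by the earlier ranks, which by induction
    follow the lexicographic order of the remaining rows. Equal columns keep their original order
    because the process starts from the identity. *)
Lemma chain_lt n B k (M : {ffun 'I_k -> {ffun 'I_n -> 'I_B.+1}}) (x y : 'I_n) :
  ((chain M)^-1%g x < (chain M)^-1%g y) =
  lex (column M x) (column M y) && ((column M x == column M y) ==> (x < y)).
Proof.
elim: k M => [|k IH] M /=.
  rewrite invg1 !perm1; have -> : column M x = column M y by apply/ffunP => -[].
  by rewrite eqxx.
have ct z : ftail (column M z) = column (ftail M) z by apply/ffunP => i; rewrite !ffunE.
rewrite sortp_lt /stable IH !ct !ffunE.
have -> : (column M x == column M y) =
    (M ord0 x == M ord0 y) && (column (ftail M) x == column (ftail M) y).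
  apply/eqP/andP => [e|[/eqP e /eqP et]].
    by rewrite -!ct e; move/ffunP: e => /(_ ord0); rewrite !ffunE => ->.
  by rewrite -(fcons_tail (column M x)) -(fcons_tail (column M y)) !ct et !ffunE e.
case: (ltngtP (M ord0 x) (M ord0 y)) => [h|h|/val_inj ->] /=.
- by rewrite -val_eqE /= (ltn_eqF h).
- by rewrite -val_eqE /= (gtn_eqF h).
- by rewrite eqxx.
Qed.

Lemma chain1 n B k (M : {ffun 'I_k -> {ffun 'I_n -> 'I_B.+1}}) :
  (chain M == 1%g) = sorted (@lex B k) (codom (column M)).
Proof.
have lT := @lex_trans B k.
apply/eqP/idP => [c1|sM].
  rewrite /codom /image_mem sorted_map.
  have := iota_ltn_sorted 0 n; rewrite -val_enum_ord sorted_map.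
  apply: sub_sorted => p q /= pq; have := chain_lt M p q.
  by rewrite c1 invg1 !perm1 pq => /esym/andP[].
have h : (chain M)^-1%g = 1%g.
  apply: perm_mono1 => p q pq; rewrite chain_lt pq implybT andbT.
  move: sM; rewrite sorted_pairwise // => /(pairwiseP (column M p)) /(_ p q).
  rewrite !inE size_codom card_ord => /(_ (ltn_ord _) (ltn_ord _) pq).
  by rewrite !nth_codom_ord.
by rewrite -(invgK (chain M)) h invg1.
Qed.

(** * Counting matrices by the effects of the successive sorts *)

Definition ncompat n B (s : 'S_n) (c : nat) :=
  #|[set l : {ffun 'I_n -> 'I_B.+1} | compat s l & \sum_p l p == c]|.

(** By [sortpE], reading [f] in the order [t] is the required bijection; permuting the entries keeps
    their sum. *)
Lemma ncompat_sortp n B (t r : 'S_n) c :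
  #|[set f : {ffun 'I_n -> 'I_B.+1} | sortp f r == t & \sum_p f p == c]| =
  ncompat B (t * r^-1)%g c.
Proof.
apply: (@card_bij_in _ _ _ _ (fun f => fperm f t) (fun f => fperm f t^-1%g)).
- move=> f; rewrite !inE sortpE => /andP[-> /eqP <-] /=.
  by apply/eqP; rewrite [RHS](reindex_perm t); apply: eq_bigr => i _; rewrite ffunE.
- move=> l; rewrite !inE sortpE => /andP[cl /eqP <-] /=.
  have -> : fperm (fperm l t^-1%g) t = l by apply/ffunP => i; rewrite !ffunE permK.
  rewrite cl /=; apply/eqP.
  by rewrite [RHS](reindex_perm t^-1%g); apply: eq_bigr => i _; rewrite ffunE.
- by move=> f _; apply/ffunP => i; rewrite !ffunE permKV.
- by move=> f _; apply/ffunP => i; rewrite !ffunE permK.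
Qed.

(** Induction on the rows: if [r] is the ordering left by rows 1 and beyond, sorting by row 0
    contributes the factor [t * r^-1], and [ncompat_sortp] counts the possible rows 0. *)
Lemma chain_count n B k (b : 'I_k -> nat) (t : 'S_n) :
  #|[set M : {ffun 'I_k -> {ffun 'I_n -> 'I_B.+1}} |
     chain M == t & [forall i, \sum_x M i x == b i]]| =
  \sum_(s : {ffun 'I_k -> 'S_n} | (\prod_(i < k) s i)%g == t)
    \prod_(i < k) ncompat B (s i) (b i).
Proof.
rewrite cardsE -sum1_card big_mkcond /= [RHS]big_mkcond /=.
elim: k b t => [|k IH] b t.
  pose f0 S : {ffun 'I_0 -> S} := ffun0 (card_ord 0) .
  rewrite (big_ffun0 _ (f0 _)) (big_ffun0 _ (f0 _)) /= unfold_in /= !big_ord0 andbC.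
  by rewrite (_ : [forall i, _] = true) //; apply/forallP => -[].
rewrite !sum_fcons.
(* Both sides are compared with a sum over the intermediate ordering [r]. *)
transitivity (\sum_(r : 'S_n) ncompat B (t * r^-1)%g (b ord0) *
  \sum_(s : {ffun 'I_k -> 'S_n} | (\prod_(i < k) s i)%g == r)
    \prod_(i < k) ncompat B (s i) (b (lift ord0 i))); last first.
  under eq_bigr do rewrite big_distrr /= big_mkcond /=.
  rewrite exchange_big /=; apply: eq_bigr => s _.
  (* The later factors force [r] to be their product, and then the first factor is forced to be
     [t * r^-1]. *)
  rewrite -big_mkcond (big_pred1 (\prod_(i < k) s i)%g) //.
  rewrite -big_mkcond /= (big_pred1 (t * (\prod_(i < k) s i)^-1)%g) /=.
    rewrite big_ord_recl fcons0; congr (_ * _).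
    by apply: eq_bigr => i _; rewrite fconsS.
  move=> x; rewrite big_ord_recl fcons0.
  rewrite (eq_bigr _ (fun i _ => fconsS x s i)).
  by apply/eqP/eqP => [<-|->]; rewrite ?mulgK ?mulgKV.
under [RHS]eq_bigr do rewrite big_mkcond -IH big_distrr /=.
rewrite [RHS]exchange_big /=; apply: eq_bigr => M _.
(* Once the rows other than row 0 are fixed, only [r = chain M] contributes. *)
rewrite (bigD1 (chain M)) //= [X in _ = _ + X]big1 ?addn0; last first.
  by move=> r rM; rewrite unfold_in eq_sym (negPf rM) muln0.
rewrite unfold_in eqxx /= -big_mkcond sum1_card -ncompat_sortp.
have H (x : {ffun 'I_n -> 'I_B.+1}) :
    [forall i, \sum_(y < n) fcons x M i y == b i] =
    (\sum_(y < n) x y == b ord0) && [forall i, \sum_(y < n) M i y == b (lift ord0 i)].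
  apply/forallP/andP => [H|[H0 /forallP H] i].
    split; first by have := H ord0; rewrite fcons0.
    by apply/forallP => i; have := H (lift ord0 i); rewrite fconsS.
  by case: (unliftP ord0 i) => [j|] ->; rewrite ?fcons0 ?fconsS.
case hM : [forall i, _]; rewrite ?muln1 ?muln0.
  by apply: eq_card => x; rewrite !inE unfold_in H hM andbT ftail_cons fcons0.
by apply: eq_card0 => x; rewrite unfold_in /= H hM !andbF.
Qed.

(** * Multisets of vectors as matrices with sorted columns *)

Lemma sum_count_mem_mul (T : finType) (s : seq T) (F : T -> nat) :
  \sum_a count_mem a s * F a = \sum_(a <- s) F a.
Proof.
elim: s => [|x s IH] /=; first by rewrite big_nil big1.
rewrite big_cons -IH; under eq_bigr do rewrite mulnDl.
rewrite big_split /= (bigD1 x) //= eqxx mul1n big1 ?addn0 // => y yx.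
by rewrite eq_sym (negPf yx).
Qed.

Lemma count_mem_expand (T : finType) (c : T -> nat) a :
  count_mem a (flatten [seq nseq (c x) x | x <- enum T]) = c a.
Proof.
rewrite count_flatten sumnE -map_comp big_map big_enum /= (bigD1 a) //= count_nseq /=.
rewrite eqxx mul1n big1 ?addn0 // => x xa.
by rewrite count_nseq /= (negPf xa).
Qed.

Lemma codom_nth (T : Type) n (x0 : T) (s : seq T) :
  size s = n -> codom (fun x : 'I_n => nth x0 s x) = s.
Proof.
move=> ss; apply: (@eq_from_nth _ x0) => [|i]; first by rewrite size_codom card_ord.
by rewrite size_codom card_ord => ilt; rewrite (nth_codom_ord _ _ (Ordinal ilt)).
Qed.

(** By [chain1] the matrices on the right are those with sorted columns. Counting columns and
    writing out a multiset in sorted order are mutually inverse, since antisymmetry of [lex] leaves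
    one sorted list for given multiplicities. *)
Lemma hcoef_chain n k (b : 'X_{1..k}) (B := \max_(i < k) b i) :
  hcoef n b = #|[set M : {ffun 'I_k -> {ffun 'I_n -> 'I_B.+1}} |
     chain M == 1%g & [forall i, \sum_x M i x == b i]]|.
Proof.
pose T := {ffun 'I_k -> 'I_B.+1}.
pose mult (M : {ffun 'I_k -> {ffun 'I_n -> 'I_B.+1}}) : {ffun T -> 'I_n.+1} :=
  [ffun a => inord (count_mem a (codom (column M)))].
pose ms (c : {ffun T -> 'I_n.+1}) : seq T :=
  sort (@lex B k) (flatten [seq nseq (c x) x | x <- enum T]).
(* The default column is never read when the multiplicities add up to [n], as [ms c] then has length
   [n]. *)
pose mx (c : {ffun T -> 'I_n.+1}) : {ffun 'I_k -> {ffun 'I_n -> 'I_B.+1}} :=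
  [ffun i => [ffun x : 'I_n => nth [ffun _ => ord0] (ms c) x i]].
have multE M a : mult M a = count_mem a (codom (column M)) :> nat.
  by rewrite ffunE inordK // ltnS (leq_trans (count_size _ _)) // size_codom card_ord.
have msE c a : count_mem a (ms c) = c a.
  by rewrite /ms (seq.permP (permEl (perm_sort _ _))) count_mem_expand.
have ms_size (c : {ffun T -> 'I_n.+1}) : \sum_a (c a : nat) = n -> size (ms c) = n.
  move=> <-; rewrite -sum1_size -(sum_count_mem_mul _ (fun=> 1)).
  by apply: eq_bigr => a _; rewrite msE muln1.
have mxE (c : {ffun T -> 'I_n.+1}) : \sum_a (c a : nat) = n -> codom (column (mx c)) = ms c.
  move=> /ms_size hs; rewrite -[RHS](@codom_nth _ n [ffun _ => ord0]) //.
  by apply: eq_codom => x; apply/ffunP => i; rewrite !ffunE.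
have sumE M i : \sum_(a <- codom (column M)) (a i : nat) = \sum_x M i x.
  by rewrite /codom /image_mem big_map big_enum /=; apply: eq_bigr => x _; rewrite !ffunE.
have ms_sorted c : sorted (@lex B k) (ms c) by apply: sort_sorted; exact: lex_total.
apply/esym; rewrite /hcoef -/B.
apply: (@card_bij_in _ _ _ _ mult mx) => [M|c|M|c]; rewrite !inE => /andP[].
- move=> _ /forallP Mb; apply/andP; split.
    under eq_bigr do rewrite multE -[count_mem _ _]muln1.
    by rewrite sum_count_mem_mul sum1_size size_codom card_ord.
  apply/forallP => i; under eq_bigr do rewrite multE.
  by rewrite (sum_count_mem_mul _ (fun a : T => a i : nat)) sumE.
- move=> /eqP cn /forallP cb; rewrite chain1 mxE // ms_sorted /=.
  apply/forallP => i; rewrite -sumE mxE //.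
  by rewrite -(sum_count_mem_mul _ (fun a : T => a i : nat)); under eq_bigr do rewrite msE.
- rewrite chain1 => sM _; have cn : \sum_a (mult M a : nat) = n.
    under eq_bigr do rewrite multE -[count_mem _ _]muln1.
    by rewrite sum_count_mem_mul sum1_size size_codom card_ord.
  have e : ms (mult M) = codom (column M).
    apply: (sorted_eq (@lex_trans _ _) (@lex_anti _ _)) => //.
    by rewrite /perm_eq; apply/allP => a _; rewrite /= msE multE.
  apply/ffunP => i; apply/ffunP => x; rewrite !ffunE e nth_codom_ord.
  by rewrite !ffunE.
- move=> /eqP cn _; apply/ffunP => a; apply/val_inj.
  by rewrite /= multE mxE // msE.
Qed.

(** * Descents, gaps and [comaj] *)

Definition desc n (s : 'S_n) (j : 'I_n) : bool :=
  [exists i : 'I_n, (val j == i.+1) && (s j < s i)].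

(** A descent is recorded at its later position [j], so at most one [i] contributes for each [j]. *)
Lemma comajE n (s : 'S_n) : comaj s = \sum_(j < n) (n - j) * desc s j.
Proof.
rewrite /comaj (exchange_big_dep predT) //=; apply: eq_bigr => j _.
rewrite sum_nat_const mulnC; congr (_ * _).
rewrite /desc; case: existsP => [[i ji]|H].
  rewrite (eq_card (_ : _ =i pred1 i)) ?card1 // => x; rewrite !inE.
  apply/idP/eqP => [/andP[/eqP h _]|-> //].
  by apply: val_inj; case/andP: ji => /eqP ji _; move: h; rewrite ji => -[].
by apply: eq_card0 => x; apply/negP => xj; apply: H; exists x.
Qed.

(** Consecutive positions suffice because the pairs [(l p, s p)] are compared lexicographically,
    which is transitive. Where there is no descent, injectivity of [s] gives [s i < s j], so a weak
    inequality on [l] is enough. *)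
Lemma compat_desc n B (s : 'S_n) (l : {ffun 'I_n -> 'I_B.+1}) :
  compat s l <-> (forall i j : 'I_n, j = i.+1 :> nat -> l i + desc s j <= l j).
Proof.
split=> [/compatP H i j ji|H].
  have := H i j; rewrite ji => /(_ (ltnSn _)); rewrite /desc -val_eqE /=.
  case: existsP => [[i' /andP[/eqP ji' sji]]|_] /=; last by lia.
  have -> : i = i' by apply: val_inj; move: ji ji' => /= -> [].
  by lia.
apply/compatP; have step (i j : 'I_n) : j = i.+1 :> nat ->
    (l i < l j) || (l i == l j) && (s i < s j).
  move=> ji; have := H i j ji; rewrite /desc -val_eqE /=.
  case: existsP => [_|nd] /=; first by lia.
  have : ~~ (s j < s i) by apply/negP => sji; apply: nd; exists i; rewrite ji eqxx.
  have : s i != s j by rewrite (inj_eq perm_inj) -val_eqE /= ji neq_ltn ltnSn.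
  by rewrite -val_eqE /=; lia.
have chainstep d : forall p q : 'I_n, q = (p + d).+1 :> nat ->
    (l p < l q) || (l p == l q) && (s p < s q).
  elim: d => [|d IH] p q qE; first by apply: step; rewrite qE addn0.
  have rlt : (p + d).+1 < n by rewrite -addnS (ltn_trans _ (ltn_ord q)) // qE.
  have := IH p (Ordinal rlt) erefl; have := step (Ordinal rlt) q.
  by rewrite /= qE addnS -!val_eqE /= => /(_ erefl); lia.
by move=> p q pq; apply: (chainstep (q - p.+1)); lia.
Qed.

(** Each [h i] is counted once for every [j >= i], that is [n - i] times. *)
Lemma sum_le_ord n (h : 'I_n -> nat) :
  \sum_(j < n) \sum_(i < n | i <= j) h i = \sum_(i < n) (n - i) * h i.
Proof.
rewrite (exchange_big_dep predT) //=; apply: eq_bigr => i _.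
rewrite sum_nat_const; congr (_ * _).
rewrite -sum1_card -[LHS](big_geq_mkord i n predT (fun=> 1)).
by rewrite sum_nat_const_nat muln1.
Qed.

Lemma sum_le_ordS n (h : 'I_n -> nat) (i j : 'I_n) : j = i.+1 :> nat ->
  \sum_(x < n | x <= j) h x = \sum_(x < n | x <= i) h x + h j.
Proof.
move=> ji; rewrite (bigD1 j) //= addnC; congr (_ + _); apply: eq_bigl => x.
by rewrite -val_eqE /=; lia.
Qed.

(** The gaps left after subtracting the forced increments are arbitrary, and [l] is recovered by
    partial sums of gaps plus increments. By [sum_le_ord] the increments contribute [comaj s] in
    total. No entry or gap exceeds [c], so the bounds [B] and [C] lose nothing. *)
Lemma ncompat_gaps n B C (s : 'S_n) c : c <= B -> c <= C ->
  ncompat B s c =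
  #|[set g : {ffun 'I_n -> 'I_C.+1} | \sum_(j < n) (n - j) * g j + comaj s == c]|.
Proof.
(* The value before position 0 is taken to be 0, so the first gap is the first entry itself. *)
move=> cB cC; pose prev (l : {ffun 'I_n -> 'I_B.+1}) (j : 'I_n) : nat :=
  if j == 0 :> nat then 0 else l (Ordinal (leq_ltn_trans (leq_pred j) (ltn_ord j))).
pose gaps (l : {ffun 'I_n -> 'I_B.+1}) : {ffun 'I_n -> 'I_C.+1} :=
  [ffun j => inord (l j - (prev l j + desc s j))].
pose h (g : {ffun 'I_n -> 'I_C.+1}) (i : 'I_n) := g i + desc s i.
pose lam (g : {ffun 'I_n -> 'I_C.+1}) : {ffun 'I_n -> 'I_B.+1} :=
  [ffun j : 'I_n => inord (\sum_(i < n | i <= j) h g i)].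
have sumh (g : {ffun 'I_n -> 'I_C.+1}) : \sum_(j < n) \sum_(i < n | i <= j) h g i =
    \sum_(j < n) (n - j) * g j + comaj s.
  rewrite sum_le_ord comajE -big_split /=; apply: eq_bigr => i _; exact: mulnDr.
have lamE (g : {ffun 'I_n -> 'I_C.+1}) (j : 'I_n) : \sum_(j < n) (n - j) * g j + comaj s = c ->
    lam g j = \sum_(i < n | i <= j) h g i :> nat.
  move=> gc; rewrite ffunE inordK // ltnS (leq_trans _ cB) // -gc -sumh.
  by rewrite [leqRHS](bigD1 j) //= leq_addr.
have gapsE (l : {ffun 'I_n -> 'I_B.+1}) (j : 'I_n) : \sum_p (l p : nat) = c ->
    gaps l j = l j - (prev l j + desc s j) :> nat.
  move=> lc; rewrite ffunE inordK // ltnS (leq_trans (leq_subr _ _)) //.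
  by rewrite (leq_trans _ cC) // -lc (bigD1 j) //= leq_addr.
have prevS (l : {ffun 'I_n -> 'I_B.+1}) (i j : 'I_n) : j = i.+1 :> nat -> prev l j = l i.
  move=> ji; rewrite /prev; case: eqP => [|_]; first by rewrite ji.
  congr (nat_of_ord (l _)).
  by apply: val_inj; rewrite /= ji.
have prev0 (l : {ffun 'I_n -> 'I_B.+1}) (j : 'I_n) : j = 0 :> nat -> prev l j = 0.
  by rewrite /prev => /eqP ->.
have desc0 (j : 'I_n) : j = 0 :> nat -> desc s j = false.
  by move=> j0; apply/negbTE/existsPn => i; rewrite /= j0.
have sum0 (f : 'I_n -> nat) (j : 'I_n) : j = 0 :> nat -> \sum_(i < n | i <= j) f i = f j.
  move=> j0; rewrite (big_pred1 j) // => i.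
  by rewrite /= -val_eqE /= j0 leqn0.
have caseO (j : 'I_n) : (j = 0 :> nat) \/ exists i : 'I_n, j = i.+1 :> nat.
  case: j => -[|j] jn /=; first by left.
  by right; exists (Ordinal (ltnW jn)).
(* Compatibility makes the truncated subtraction in [gaps] exact, and the partial sums telescope. *)
have lamK (l : {ffun 'I_n -> 'I_B.+1}) : compat s l -> \sum_p (l p : nat) = c ->
    forall j : 'I_n, \sum_(i < n | i <= j) h (gaps l) i = l j.
  move=> /compat_desc cl lc [j jn]; elim: j jn => [|j IH] jn.
    by rewrite sum0 // /h gapsE // prev0 // desc0 // addn0 subn0.
  rewrite (@sum_le_ordS _ _ (Ordinal (ltnW jn))) // IH /h gapsE //.
  by have := cl (Ordinal (ltnW jn)) (Ordinal jn) erefl; rewrite (@prevS _ (Ordinal (ltnW jn))) //; lia.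
apply: (@card_bij_in _ _ _ _ gaps lam) => [l|g|l|g]; rewrite !inE.
- move=> /andP[cl /eqP lc]; rewrite -sumh -lc; apply/eqP.
  by apply: eq_bigr => j _; exact: lamK.
- move=> /eqP gc; apply/andP; split.
    apply/compat_desc => i j ji; rewrite !lamE // (sum_le_ordS _ ji) /h; lia.
  by rewrite -gc -sumh; apply/eqP/eq_bigr => j _; exact: lamE.
- move=> /andP[cl /eqP lc]; apply/ffunP => j; apply: val_inj => /=.
  by rewrite ffunE lamK // inord_val.
- move=> /eqP gc; have lc : \sum_p (lam g p : nat) = c.
    by rewrite -[RHS]gc -sumh; apply/eq_bigr => j _; exact: lamE.
  apply/ffunP => j; apply: val_inj => /=; rewrite gapsE // lamE //.
  case: (caseO j) => [j0|[i ji]].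
    by rewrite sum0 // /h prev0 // desc0 //; lia.
  by rewrite (prevS _ _ _ ji) lamE // (sum_le_ordS _ ji) /h; lia.
Qed.

(** * Generating functions in one variable *)

Local Open Scope ring_scope.

(* Power series q^c / (q; q)_n, correct up to degree C. *)
Definition gappoly n C (c : nat) : {poly int} :=
  'X^c * \prod_(j < n) \sum_(v < C.+1) 'X^((n - j) * v).

(** Expanding the product, a choice of one term per factor is a gap sequence. In particular
    [ncompat B s c] is independent of [B] as soon as [c <= B]. *)
Lemma coef_gappoly n B C (s : 'S_n) c : (c <= B)%N -> (c <= C)%N ->
  (gappoly n C (comaj s))`_c = (ncompat B s c)%:Z.
Proof.
move=> cB cC; rewrite (ncompat_gaps s cB cC) /gappoly bigA_distr_bigA /=.
rewrite big_distrr coef_sum /= -sum1_card -natz natr_sum [RHS]big_mkcond /=.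
apply: eq_bigr => g _; rewrite prodrXr -exprD coefXn inE addnC eq_sym.
by case: eqP.
Qed.

(** This is [(q; q)_n] in one variable, into which each ['X_i] is later substituted. *)
Definition qfact n : {poly int} := \prod_(j < n) (1 - 'X * 'X^j).

Lemma qfactE n : qfact n = \prod_(j < n) (1 - 'X^(n - j)).
Proof.
rewrite /qfact (reindex_inj rev_ord_inj); apply: eq_bigr => j _.
by rewrite -exprS /= subnSK.
Qed.

(** Being congruent to 1 modulo ['X^N] is stable under products. *)
Lemma prod_1subXn n N (e : 'I_n -> nat) : (forall j, N <= e j)%N ->
  exists R : {poly int}, \prod_(j < n) (1 - 'X^(e j)) = 1 + 'X^N * R.
Proof.
move=> eN; apply: (big_ind (fun p : {poly int} => exists R, p = 1 + 'X^N * R)) => [|p q [P ->] [Q ->]|j _].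
- by exists 0; rewrite mulr0 addr0.
- by exists (P + Q + 'X^N * P * Q); ring.
- by exists (- 'X^(e j - N)); rewrite mulrN -exprD subnKC.
Qed.

(** Each factor telescopes against its truncated geometric series to [1 - 'X^((n - j) * C.+1)].
    Since [n - j >= 1], these are all 1 up to degree [C], and only ['X^c] remains. *)
Lemma qfact_gappoly n C c d : (d <= C)%N ->
  (qfact n * gappoly n C c)`_d = (d == c)%:R.
Proof.
move=> dC; rewrite /gappoly mulrCA qfactE -big_split /=.
have -> : \prod_(j < n) ((1 - 'X^(n - j)) * \sum_(v < C.+1) 'X^((n - j) * v)) =
    \prod_(j < n) (1 - 'X^((n - j) * C.+1)) :> {poly int}.
  apply: eq_bigr => j _; under eq_bigr do rewrite exprM.
  by rewrite -opprB mulNr -subrX1 opprB exprM.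
have [j|R ->] := @prod_1subXn n C.+1 (fun j => (n - j) * C.+1)%N.
  by rewrite leq_pmull // subn_gt0.
rewrite mulrDr mulr1 coefD coefXn mulrCA coefXnM ltnS dC addr0.
by [].
Qed.

(** This is the Cauchy product in [qfact_gappoly], indexed by ['I_B.+1] so that all rows share one
    index type whatever their [c]. *)
Lemma ncompat_qfact n B (s : 'S_n) c : (c <= B)%N ->
  \sum_(j < B.+1 | (j <= c)%N) (qfact n)`_j * (ncompat B s (c - j))%:Z = (c == comaj s)%:R.
Proof.
move=> cB; rewrite -(@qfact_gappoly n B) // coefM.
rewrite -[RHS](big_mkord predT (fun j => (qfact n)`_j * (gappoly n B (comaj s))`_(c - j))).
rewrite (big_nat_widen _ _ B.+1) // big_mkord /=.
apply: eq_big => [j|j jc]; first by rewrite ltnS.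
by rewrite (@coef_gappoly _ B) // (leq_trans (leq_subr _ _)).
Qed.

(** * Coefficients of polynomials in several variables *)

Lemma mcoeff_prod_horner (R : comNzRingType) k (p : 'I_k -> {poly R}) (m : 'X_{1..k}) :
  (\prod_(i < k) (map_poly (@mpolyC k R) (p i)).['X_i])@_m = \prod_(i < k) (p i)`_(m i).
Proof.
(* [N] bounds all sizes and all [m i], so the expansions and [m] itself are indexed by functions
   into ['I_N.+1]. *)
pose N := (\max_(i < k) maxn (size (p i)) (m i))%N.
have pN i : (maxn (size (p i)) (m i) <= N)%N by apply: (leq_bigmax i).
have hE i : (map_poly (@mpolyC k R) (p i)).['X_i] =
    \sum_(j < N.+1) ((p i)`_j)%:MP * 'X_i ^+ j.
  rewrite (@horner_coef_wide _ N.+1).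
    by apply: eq_bigr => j _; rewrite coef_map.
  by rewrite (leq_trans (size_poly _ _)) // (leq_trans _ (leqnSn _)) //
    (leq_trans _ (pN i)) // leq_maxl.
under eq_bigr do rewrite hE.
have fE (f : {ffun 'I_k -> 'I_N.+1}) :
    \prod_i (((p i)`_(f i))%:MP * 'X_i ^+ f i) =
    (\prod_i (p i)`_(f i)) *: 'X_[R, [multinom f i : nat | i < k]].
  rewrite big_split /= -rmorph_prod mul_mpolyC; congr (_ *: _).
  by rewrite mpolyXE_id; apply: eq_bigr => i _; rewrite mnmE.
pose fm : {ffun 'I_k -> 'I_N.+1} := [ffun i => inord (m i)].
have fmE i : fm i = m i :> nat.
  by rewrite ffunE inordK // ltnS (leq_trans _ (pN i)) // leq_maxr.
rewrite bigA_distr_bigA (eq_bigr _ (fun f _ => fE f)) raddf_sum /=.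
(* The factors involve distinct variables, so [fm] is the only choice of terms with monomial [m]. *)
rewrite (bigD1 fm) //= [X in _ + X]big1 ?addr0 => [|f nf]; rewrite mcoeffZ mcoeffX.
  rewrite (_ : [multinom _ | i < k] == m) ?mulr1.
    by apply: eq_bigr => i _; rewrite fmE.
  by apply/eqP/mnmP => i; rewrite mnmE fmE.
case: eqP => [/mnmP e|]; last by rewrite mulr0.
case/eqP: nf; apply/ffunP => i; apply: val_inj => /=.
by rewrite fmE -e mnmE.
Qed.

Lemma mcoeff_denom n k (m : 'X_{1..k}) :
  (denom k n)@_m = \prod_(i < k) (qfact n)`_(m i).
Proof.
rewrite -mcoeff_prod_horner; congr (_ @_ m); apply: eq_bigr => i _.
rewrite /qfact /qpoch rmorph_prod horner_prod; apply: eq_bigr => j _.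
by rewrite rmorphB rmorph1 rmorphM rmorphXn /= map_polyX !hornerE.
Qed.

(** Exponents below [b] fit in the box, and those outside the support have coefficient 0. A sum over
    functions can then be factored row by row. *)
Lemma sum_msupp_box k B (D : {mpoly int[k]}) (b : 'X_{1..k}) (G : 'X_{1..k} -> int) :
    (forall i, b i <= B)%N ->
  \sum_(m <- msupp D | lem m b) D@_m * G m =
  \sum_(f : {ffun 'I_k -> 'I_B.+1} | [forall i, f i <= b i]%N)
    D@_[multinom f i : nat | i < k] * G [multinom f i : nat | i < k].
Proof.
move=> bB; pose mn (f : {ffun 'I_k -> 'I_B.+1}) := [multinom f i : nat | i < k].
have mnE f i : mn f i = f i by rewrite mnmE.
have mn_inj : injective mn.
  by move=> f g /mnmP e; apply/ffunP => i; apply: val_inj => /=; rewrite -!mnE e.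
transitivity (\sum_(f | lem (mn f) b) D@_(mn f) * G (mn f)); last first.
  by apply: eq_bigl => f; apply: eq_forallb => i; rewrite mnE.
rewrite -(big_map mn (fun m => lem m b) (fun m => D@_m * G m)).
rewrite [RHS](bigID (mem (msupp D))) /= [X in _ = _ + X]big1 ?addr0; last first.
  by move=> m /andP[_ /memN_msupp_eq0 ->]; rewrite mul0r.
rewrite -[LHS]big_filter -[RHS]big_filter; apply: perm_big; apply: uniq_perm.
- by rewrite filter_uniq // msupp_uniq.
- by rewrite filter_uniq // map_inj_uniq // index_enum_uniq.
move=> m; rewrite !mem_filter -andbA; case: (boolP (lem m b)) => //= /mnm_lepP mb.
rewrite -[LHS]andbT; congr andb; apply/esym/mapP.
exists [ffun i => inord (m i)]; first by rewrite mem_index_enum.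
apply/mnmP => i; rewrite mnE ffunE inordK // ltnS.
exact: leq_trans (mb i) (bB i).
Qed.

(* Formal power series identity h_n[...] = numer / denom, stated
   coefficientwise as denom * h_n[...] = numer (denom has constant term 1,
   hence is invertible in Z[[q_1..q_k]]). *)
Theorem theorem11 (n k : nat) (hn : (1 <= n)%N) (hk : (1 <= k)%N) :
  forall b : 'X_{1..k}, mul_hcoef n (denom k n) b = ((numer k n)@_b)%R.
Proof.
move=> b; pose B := (\max_(i < k) b i)%N.
have bB i : (b i <= B)%N by apply: (leq_bigmax i).
have hE (f : {ffun 'I_k -> 'I_B.+1}) :
    [forall i, f i <= b i]%N ->
    (hcoef n (mnm_sub b [multinom f i : nat | i < k]))%:Z =
    \sum_(s : {ffun 'I_k -> 'S_n} | (\prod_(i < k) s i)%g == 1%g)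
      \prod_(i < k) (ncompat B (s i) (b i - f i)%N)%:Z.
  move=> _; rewrite hcoef_chain chain_count -natz natr_sum.
  apply: eq_bigr => s _; rewrite natr_prod; apply: eq_bigr => i _.
  (* The entry bound in [hcoef] varies with [f]; passing through [gappoly] replaces it by the common
     bound [B]. *)
  set B' := (\max_(i < k) _)%N.
  have le' : (b i - f i <= B')%N.
    by have := @leq_bigmax _ (mnm_sub b [multinom f i : nat | i < k]) i; rewrite mnmBE mnmE.
  have le : (b i - f i <= B)%N by rewrite (leq_trans (leq_subr _ _)).
  by rewrite mnmBE mnmE natz -(coef_gappoly _ le' le') -(coef_gappoly _ le le').
rewrite /mul_hcoef (sum_msupp_box _ _ bB).
under eq_bigr => f fb do rewrite hE // mcoeff_denom big_distrr /=.
rewrite exchange_big /numer raddf_sum /=; apply: eq_bigr => s _.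
(* Extending by zero removes the condition on [f], so the sum of products becomes a product of
   sums. *)
pose F (i : 'I_k) (j : 'I_B.+1) : int :=
  if (j <= b i)%N then (qfact n)`_j * (ncompat B (s i) (b i - j))%:Z else 0.
transitivity (\sum_(f : {ffun 'I_k -> 'I_B.+1}) \prod_(i < k) F i (f i)).
  rewrite big_mkcond; apply: eq_bigr => f _; case: ifP => [/forallP fb|/negbT].
    by rewrite -big_split; apply: eq_bigr => i _; rewrite /F fb mnmE.
  rewrite negb_forall => /existsP[i /negbTE nfi].
  by rewrite (bigD1 i) //= /F nfi mul0r.
rewrite -bigA_distr_bigA /= mcoeffX.
(* Each factor becomes the indicator of [b i = comaj (s i)], and their product is the coefficient at
   [b] of the monomial of [s]. *)
under eq_bigr do rewrite /F -big_mkcond ncompat_qfact //.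
case: eqP => [/mnmP e|ne].
  by apply: big1 => i _; rewrite -e mnmE eqxx.
have /existsP[i /negbTE ni] : [exists i, b i != comaj (s i)].
  rewrite -negb_forall; apply/forallP => e; apply: ne; apply/mnmP => i.
  by rewrite mnmE (eqP (e i)).
by rewrite (bigD1 i) //= ni mul0r.
Qed.
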